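(* There is an absolute constant $C>0$ such that the following holds. Let $w:\mathbb{N}\to(0,\infty)$ be monotonically increasing to infinity. Then there exists a complete orthonormal system $\{\phi_n\}_{n=1}^{\infty}$ on $\mathbb{T}$ such that for all sufficiently large $N\in\mathbb{N}$, $$\|f\|_{L^2(V^2)}\le C\,w(N)\left(\sum_{n=1}^{N}|a_n|^2\right)^{1/2}$$ for all $f$ of the form $f(x)=\sum_{n=1}^{N}a_n\phi_n(x)$.
   Context: $\mathbb{T}=[0,1]$ with Lebesgue measure. An orthonormal system is an ordered sequence of real or complex valued functions orthonormal in $L^2(\mathbb{T})$; it is complete if its linear span is dense in $L^2(\mathbb{T})$. For a finite sequence $b=(b_n)_{n=1}^{N}$ of complex numbers, $\|b\|_{V^2}=\sup_{\mathcal{P}}\left(\sum_{I\in\mathcal{P}}\left|\sum_{n\in I}b_n\right|^2\right)^{1/2}$, the supremum being over all partitions $\mathcal{P}$ of $\{1,\dots,N\}$ into disjoint subintervals. For $f=\sum_{n=1}^{N}a_n\phi_n$, $\|f\|_{L^2(V^2)}$ is the $L^2(\mathbb{T})$ norm of $x\mapsto\|\{a_n\phi_n(x)\}_{n=1}^{N}\|_{V^2}$. *)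

(* Defs.v *)
From HB Require Import structures.
From mathcomp Require Import all_boot all_order all_algebra.
From mathcomp Require Import all_classical all_reals all_analysis.
From mathcomp Require Export complex.

Set Implicit Arguments.
Unset Strict Implicit.
Unset Printing Implicit Defensive.

Import Order.TTheory GRing.Theory Num.Theory.
Import numFieldTopology.Exports numFieldNormedType.Exports.

Local Open Scope classical_set_scope.
Local Open Scope ring_scope.
Local Open Scope complex_scope.

(* Functions on the interval [0, 1] are represented by functions on R, of
   which only the values on [0, 1] are used. *)
Definition L2norm (R : realType) (g : R -> R) : \bar R :=
  'N[lebesgue_measure]_2%:E [(EFin \o g) \_ (`[0, 1] : set R)].

Definition in_L2 (R : realType) (f : R -> R[i]) : Prop :=
  [/\ measurable_fun (`[0, 1] : set R) (fun x => complex.Re (f x)),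
      measurable_fun (`[0, 1] : set R) (fun x => complex.Im (f x)) &
      (L2norm (fun x => Normc.normc (f x)) < +oo)%E].

Definition L2inner (R : realType) (f g : R -> R[i]) : R[i] :=
  (\int[lebesgue_measure]_(x in `[0, 1]) complex.Re (f x * (g x)^*))
  +i* (\int[lebesgue_measure]_(x in `[0, 1]) complex.Im (f x * (g x)^*)).

(* A system phi_1, phi_2, ... is indexed from 0: phi n stands for
   phi_(n + 1), so that phi_1, ..., phi_N are the phi n with n < N. *)
Definition orthonormal_system (R : realType) (phi : nat -> R -> R[i]) : Prop :=
  (forall n, in_L2 (phi n)) /\
  (forall m n, L2inner (phi m) (phi n) = (m == n)%:R).

Definition complete_system (R : realType) (phi : nat -> R -> R[i]) : Prop :=
  forall f : R -> R[i], in_L2 f -> forall e : R, 0 < e ->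
  exists (n : nat) (c : 'I_n -> R[i]),
    (L2norm (fun x => Normc.normc (f x - \sum_(k < n) c k * phi k x)%R) < e%:E)%E.

Definition subinterval N (I : {set 'I_N}) : bool :=
  [exists i : 'I_N, exists j : 'I_N, I == [set n : 'I_N | (i <= n <= j)%N]%SET].

Definition interval_partition N (P : {set {set 'I_N}}) : bool :=
  finset.partition P [set: 'I_N]%SET && [forall I in P, subinterval I].

(* There are finitely many partitions and the quantities are nonnegative, so
   the supremum is a maximum with default value 0. *)
Definition V2norm (R : realType) N (b : 'I_N -> R[i]) : R :=
  \big[Num.max/0]_(P : {set {set 'I_N}} | interval_partition P)
    Num.sqrt (\sum_(I in P) Normc.normc (\sum_(n in I) b n) ^+ 2).

Definition L2V2norm (R : realType) (phi : nat -> R -> R[i])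
    N (a : 'I_N -> R[i]) : \bar R :=
  L2norm (fun x => V2norm (fun n : 'I_N => a n * phi n x)).

(* Main.v *)
Require Import Defs.
From HB Require Import structures.
From mathcomp Require Import all_boot all_order all_algebra.
From mathcomp Require Import all_classical all_reals all_analysis.
From mathcomp Require Import measurable_realfun complex.
From mathcomp Require Import ring lra zify.

(** The system is a rearrangement of the Haar basis, and the constant is 1.

    The idea is to order the basis so that, at every point x, very few of the
    first N functions are nonzero.  If at most M of the numbers
    b_n = a_n phi_n(x), n < N, are nonzero, the Cauchy-Schwarz inequality on
    each block of a partition bounds the square of the V^2 norm of b by
    M times the sum of the |b_n|^2 ([V2norm_le]).  Integrating over x, where
    each phi_n has norm 1, the theorem follows as soon as M <= w(N)^2.

    The Haar basis contains an infinite family with pairwise disjoint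
    supports: the wavelets supported in [2^-(n+1), 2^-n[
    ([separated_support]).  As w tends to infinity, there is a sparse increasing
    sequence of positions p_0 < p_1 < ... with w(p_k) >= k + 2
    ([sparse_sequence]).  Away from the positions p_k only functions of the
    disjoint family are used; everything else is placed at the positions p_k
    ([interleave_bijection]).  At a given point at most one of the former is
    nonzero, and if K of the positions p_k lie below N then w(N) >= K + 1
    ([active_card]).

    Orthonormality of the Haar functions ([haar_orthonormal]) holds because
    the product of two of them is a multiple of the one with the larger index,
    which has mean zero.
    For completeness ([l2_approx_dense]), the functions on [0, 1[ that are
    L^2 limits of linear combinations of the system form a vector space closed
    under dominated pointwise limits.  It contains the indicators of dyadic
    intervals, hence of rays, hence of Borel sets by the pi-lambda theorem,
    hence simple functions and finally all square integrable functions.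
    Working on the half-open interval keeps the partition into dyadic
    intervals exact at every point. *)

Set Implicit Arguments.
Unset Strict Implicit.
Unset Printing Implicit Defensive.

Import Order.TTheory GRing.Theory Num.Theory.
Import numFieldTopology.Exports numFieldNormedType.Exports.

Local Open Scope classical_set_scope.
Local Open Scope ring_scope.
Local Open Scope complex_scope.

(** * The Haar system *)

(** The indicator function of the dyadic interval [k 2^-j, (k+1) 2^-j[. *)
Definition dyadic_cell (R : realType) (j k : nat) : R -> R :=
  \1_(`[k%:R / 2 ^+ j, k.+1%:R / 2 ^+ j[%classic : set R).

(** The integer whose binary digits are the first [j] binary digits of [x], for
    [x] in [0, 1[: the index of the dyadic interval of level [j] containing
    [x]. *)
Definition digits (R : realType) (j : nat) (x : R) : nat :=
  Num.Def.trunc (2 ^+ j * x).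

Lemma dyadic_cellE (R : realType) j k (x : R) : 0 <= x ->
  dyadic_cell j k x = (digits j x == k)%:R.
Proof.
move=> x0; rewrite /dyadic_cell /digits indicE; congr (_%:R); congr nat_of_bool.
rewrite truncn_eq ?mulr_ge0 ?exprn_ge0//.
rewrite mem_setE in_itv /=.
by rewrite ler_pdivrMr ?exprn_gt0// ltr_pdivlMr ?exprn_gt0// ![x * _]mulrC.
Qed.

Lemma digits_half (R : realType) j (x : R) : 0 <= x ->
  digits j x = (digits j.+1 x)./2.
Proof.
move=> x0; apply/eqP; rewrite /digits truncn_eq ?mulr_ge0 ?exprn_ge0//.
rewrite exprS -mulrA; set y := 2 ^+ j * x.
have y0 : 0 <= y by rewrite mulr_ge0 ?exprn_ge0.
have /truncn_itv : 0 <= 2 * y by rewrite mulr_ge0.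
set d := Num.Def.trunc _; move=> /andP[h1 h2].
have e : (d%:R : R) = (odd d)%:R + d./2%:R *+ 2.
  by rewrite -{1}(odd_double_half d) natrD -muln2 natrM mulr_natr.
have := e; case: (odd d) => /= e1; apply/andP; split; lra.
Qed.

Lemma digits_div (R : realType) i j (x : R) : 0 <= x ->
  digits j x = (digits (j + i) x %/ 2 ^ i)%N.
Proof.
move=> x0; elim: i => [|i IH]; first by rewrite addn0 expn0 divn1.
by rewrite IH addnS (digits_half (j + i)) // -divn2 -divnMA -expnS.
Qed.

Lemma digits_lt (R : realType) j (x : R) : 0 <= x < 1 -> (digits j x < 2 ^ j)%N.
Proof.
move=> /andP[x0 x1]; rewrite /digits truncn_lt_nat ?mulr_ge0 ?exprn_ge0//.
by rewrite natrX gtr_pMr// exprn_gt0.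
Qed.

Lemma digits0 (R : realType) (x : R) : 0 <= x < 1 -> digits 0 x = 0%N.
Proof. by move=> /(digits_lt 0); rewrite expn0 ltnS leqn0 => /eqP. Qed.

Lemma measurable_dyadic_cell (R : realType) j k (D : set R) :
  measurable_fun D (dyadic_cell j k : R -> R).
Proof. exact: measurable_indic. Qed.

Lemma Rintegral_dyadic_cell (R : realType) j k : (k < 2 ^ j)%N ->
  \int[@lebesgue_measure R]_(x in `[0, 1[) (dyadic_cell j k x) = (2 ^+ j)^-1.
Proof.
move=> kj; rewrite /Rintegral integral_indic//.
have k1 : (k.+1%:R / 2 ^+ j : R) <= 1.
  by rewrite ler_pdivrMr ?exprn_gt0// mul1r -natrX ler_nat.
have k0 : (0 : R) <= k%:R / 2 ^+ j by rewrite divr_ge0 ?exprn_ge0.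
have kk : (k%:R / 2 ^+ j : R) < k.+1%:R / 2 ^+ j.
  by rewrite ltr_pM2r ?invr_gt0 ?exprn_gt0// ltr_nat.
rewrite setIidl; last first.
  move=> x /=; rewrite !in_itv/= => /andP[a b].
  by rewrite (le_trans k0 a) (lt_le_trans b k1).
have := @lebesgue_measure_itv R `[k%:R / 2 ^+ j, k.+1%:R / 2 ^+ j[ => /= ->.
rewrite lte_fin kk /= -mulrBl -natrB// subSnn mul1r //.
Qed.

Lemma integrable_dyadic_cell (R : realType) j k :
  (@lebesgue_measure R).-integrable `[0, 1[ (EFin \o dyadic_cell j k).
Proof.
apply: (@integrableS _ _ _ _ setT) => //; exact: integrable_indic_itv.
Qed.

(** The wavelet supported in the [k]-th dyadic interval of level [j], of
    norm 1: positive on the left half of the interval, negative on the right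
    half. *)
Definition haar_wavelet (R : realType) (j k : nat) (x : R) : R :=
  Num.sqrt (2 ^+ j) * (dyadic_cell j.+1 k.*2 x - dyadic_cell j.+1 k.*2.+1 x).

(** The Haar system as a sequence: the constant function 1 on [0, 1[ has
    index 0, and the wavelet ([j], [k]) with [k < 2 ^ j] has index
    [2 ^ j + k]. *)
Definition haar (R : realType) (m : nat) : R -> R :=
  if m is 0 then dyadic_cell 0 0
  else haar_wavelet (trunc_log 2 m) (m - 2 ^ trunc_log 2 m).

Lemma haarE (R : realType) j k : (k < 2 ^ j)%N ->
  haar (2 ^ j + k) = haar_wavelet j k :> (R -> R).
Proof.
move=> kj; have e : trunc_log 2 (2 ^ j + k) = j.
  by apply: trunc_log_eq; rewrite // leq_addr expnS mul2n -addnn ltn_add2l.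
have := expn_gt0 2 j; rewrite /haar e addKn.
by case: (2 ^ j + k)%N (leq_addr k (2 ^ j)) => // /[!leqn0] /eqP ->.
Qed.

(** Every positive index is that of a wavelet. *)
Variant haar_index_spec (m : nat) : Prop :=
  HaarIndex j k of (k < 2 ^ j)%N & m = (2 ^ j + k)%N.

Lemma haar_indexP m : (0 < m)%N -> haar_index_spec m.
Proof.
move=> m0; have /andP[a b] := trunc_log_bounds (isT : (1 < 2)%N) m0.
exists (trunc_log 2 m) (m - 2 ^ trunc_log 2 m)%N; last by rewrite subnKC.
by rewrite ltn_subLR// addnn -mul2n -expnS.
Qed.

Lemma haar_waveletE (R : realType) j k (x : R) : 0 <= x ->
  haar_wavelet j k x = Num.sqrt (2 ^+ j) *
    ((digits j.+1 x == k.*2)%:R - (digits j.+1 x == k.*2.+1)%:R).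
Proof. by move=> x0; rewrite /haar_wavelet !dyadic_cellE. Qed.

Lemma haar_wavelet_support (R : realType) j k (x : R) : 0 <= x ->
  haar_wavelet j k x != 0 -> digits j x = k.
Proof.
move=> x0; rewrite haar_waveletE// (digits_half j x0).
case: (_ =P k.*2) => [-> _|_]; first by rewrite doubleK.
case: (_ =P k.*2.+1) => [-> _|_]; first by rewrite /= uphalf_double.
by rewrite subrr mulr0 eqxx.
Qed.

Lemma haar_wavelet_sqr (R : realType) j k (x : R) : 0 <= x ->
  haar_wavelet j k x ^+ 2 = 2 ^+ j * dyadic_cell j k x.
Proof.
move=> x0; rewrite haar_waveletE// dyadic_cellE// (digits_half j x0) exprMn.
rewrite sqr_sqrtr ?exprn_ge0//; congr (_ * _).
case: (_ =P k.*2) => [->|h1].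
  by rewrite doubleK eqxx; case: eqP => /=; [lia|lra].
case: (_ =P k.*2.+1) => [->|h2].
  by rewrite /= uphalf_double eqxx sub0r sqrrN expr1n.
case: eqP => [h|_]; last by rewrite subrr expr0n.
by exfalso; move: (odd_double_half (digits j.+1 x)) h1 h2; rewrite h; case: odd; lia.
Qed.

(** The first factor is constant on the support of the second, unless the two
    have the same level, in which case their supports are disjoint. *)
Lemma haar_mul (R : realType) m n : (m < n)%N ->
  exists c : R, forall x : R, 0 <= x < 1 -> haar m x * haar n x = c * haar n x.
Proof.
case: m => [|m] mn.
  exists 1 => x x1; rewrite /haar dyadic_cellE; last by case/andP: x1.
  by rewrite digits0.
have [j k kj mE] := haar_indexP (isT : 0 < m.+1)%N.
have [j' k' kj' nE] := haar_indexP (leq_ltn_trans (leq0n _) mn).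
rewrite mE nE !haarE//.
have jj' : (j <= j')%N.
  rewrite leqNgt; apply/negP => j'j.
  have : (2 ^ j'.+1 <= 2 ^ j)%N by rewrite leq_exp2l.
  by move: mn; rewrite mE nE expnS; move: kj'; lia.
move: jj'; rewrite leq_eqVlt => /orP[/eqP jE|jj'].
  exists 0 => x /andP[x0 _]; rewrite mul0r.
  apply/eqP; rewrite mulf_eq0; apply/negPn; rewrite negb_or.
  apply/negP => /andP[/(haar_wavelet_support x0) h1 /(haar_wavelet_support x0) h2].
  by move: mn; rewrite mE nE -h1 -h2 -jE ltnn.
pose d := (k' %/ 2 ^ (j' - j.+1))%N.
(* [d] is the index of the interval of level [j.+1] that contains the support of the
   second wavelet. *)
exists (Num.sqrt (2 ^+ j) * ((d == k.*2)%:R - (d == k.*2.+1)%:R)) => x /andP[x0 _].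
have [->|/(haar_wavelet_support x0) h] := eqVneq (haar_wavelet j' k' x) 0.
  by rewrite !mulr0.
rewrite (haar_waveletE j)// (digits_div (j' - j.+1))// subnKC// h.
by [].
Qed.

Lemma integrable_haar_wavelet (R : realType) j k :
  (@lebesgue_measure R).-integrable `[0, 1[ (EFin \o haar_wavelet j k).
Proof.
rewrite [X in _.-integrable _ X](_ : _ = (fun x => (Num.sqrt (2 ^+ j))%:E *
  ((EFin \o dyadic_cell j.+1 k.*2) x - (EFin \o dyadic_cell j.+1 k.*2.+1) x))%E); last first.
  by apply/funext => x /=; rewrite -EFinB -EFinM.
apply: integrableZl => //; apply: integrableB => //; exact: integrable_dyadic_cell.
Qed.

Lemma Rintegral_haar_wavelet (R : realType) j k : (k < 2 ^ j)%N ->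
  \int[@lebesgue_measure R]_(x in `[0, 1[) (haar_wavelet j k x) = 0.
Proof.
move=> kj; rewrite RintegralZl//; last first.
  rewrite [X in _.-integrable _ X](_ : _ =
   ((EFin \o dyadic_cell j.+1 k.*2) \- (EFin \o dyadic_cell j.+1 k.*2.+1))%E)//.
  by apply: integrableB => //; exact: integrable_dyadic_cell.
rewrite RintegralB//; try exact: integrable_dyadic_cell.
rewrite !Rintegral_dyadic_cell ?subrr ?mulr0//; rewrite expnS; lia.
Qed.

Lemma integrable_haar (R : realType) m :
  (@lebesgue_measure R).-integrable `[0, 1[ (EFin \o haar m).
Proof.
by case: m => [|m]; [exact: integrable_dyadic_cell|exact: integrable_haar_wavelet].
Qed.

Lemma measurable_haar (R : realType) m (D : set R) :
  measurable_fun D (haar m : R -> R).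
Proof.
case: m => [|m]; first exact: measurable_dyadic_cell.
apply: measurable_funM => //.
by apply: measurable_funB; exact: measurable_dyadic_cell.
Qed.

Theorem haar_orthonormal (R : realType) m n :
  \int[@lebesgue_measure R]_(x in `[0, 1[) (haar m x * haar n x) = (m == n)%:R.
Proof.
wlog mn : m n / (m <= n)%N => [hw|].
  have [/hw//|/ltnW/hw] := leqP m n.
  rewrite eq_sym => <-; congr (Rintegral _ _ _); apply/funext => x.
  exact: mulrC.
move: mn; rewrite leq_eqVlt => /orP[/eqP <-|mn].
  rewrite eqxx; case: m => [|m].
    rewrite (_ : true%:R = (2 ^+ 0)^-1 :> R); last by rewrite expr0 invr1.
    rewrite -(@Rintegral_dyadic_cell _ 0 0)//; apply: eq_Rintegral => x.
    rewrite inE /= in_itv/= => x01; rewrite dyadic_cellE; last by case/andP: x01.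
    by rewrite digits0// eqxx mulr1.
  have [j k kj ->] := haar_indexP (isT : 0 < m.+1)%N; rewrite haarE//.
  rewrite (_ : true%:R = 2 ^+ j * (2 ^+ j)^-1 :> R); last first.
    by rewrite mulfV// expf_neq0.
  rewrite -(Rintegral_dyadic_cell _ kj) -RintegralZl//; last first.
    exact: integrable_dyadic_cell.
  apply: eq_Rintegral => x; rewrite inE /= in_itv/= => /andP[x0 _].
  by rewrite -expr2 haar_wavelet_sqr.
rewrite ltn_eqF//; have [c hc] := haar_mul R mn.
transitivity (\int[@lebesgue_measure R]_(x in `[0, 1[) (c * haar n x)).
  by apply: eq_Rintegral => x; rewrite inE /= in_itv/= => /hc.
rewrite RintegralZl//; last exact: integrable_haar.
have [j k kj ->] := haar_indexP (leq_ltn_trans (leq0n _) mn).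
by rewrite haarE// Rintegral_haar_wavelet// mulr0.
Qed.

(** * Approximation in mean square *)

(** The linear combination of the first [n] functions of [phi] with
    coefficients [c]. *)
Definition lincomb (R : realType) (phi : nat -> R -> R) (n : nat)
  (c : nat -> R) (x : R) : R := \sum_(k < n) c k * phi k x.

(** [u] is measurable on [0, 1[ and is a limit, in mean square on [0, 1[, of
    linear combinations of the functions [phi k]. *)
Definition l2_approx (R : realType) (phi : nat -> R -> R) (u : R -> R) : Prop :=
  measurable_fun (`[0, 1[ : set R) u /\
  forall e : R, 0 < e -> exists n c,
    (\int[lebesgue_measure]_(x in `[0%R, 1%R[)
       ((u x - lincomb phi n c x) ^+ 2)%:E < e%:E)%E.

Lemma measurable_lincomb (R : realType) (phi : nat -> R -> R) n c (D : set R) :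
  (forall k, measurable_fun D (phi k)) -> measurable_fun D (lincomb phi n c).
Proof.
move=> mphi; apply: measurable_sum => k; exact: measurable_funM.
Qed.

Lemma lincomb_widen (R : realType) (phi : nat -> R -> R) n m c : (n <= m)%N ->
  lincomb phi n c =
  lincomb phi m (fun k => if (k < n)%N then c k else 0).
Proof.
move=> nm; apply/funext => x; rewrite /lincomb.
rewrite (big_ord_widen m (fun k => c k * phi k x) nm) big_mkcond/=.
by apply: eq_bigr => k _; case: ifP => // _; rewrite mul0r.
Qed.

Lemma lincombD (R : realType) (phi : nat -> R -> R) n m c d :
  exists b, forall x, lincomb phi n c x + lincomb phi m d x =
    lincomb phi (maxn n m) b x.
Proof.
rewrite (lincomb_widen phi c (leq_maxl n m)) (lincomb_widen phi d (leq_maxr n m)).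
set c' := fun k => if _ then c k else _; set d' := fun k => if _ then d k else _.
exists (fun k => c' k + d' k) => x; rewrite /lincomb -big_split/=.
by apply: eq_bigr => k _; rewrite mulrDl.
Qed.

Lemma integral_sqr_le (R : realType) (f g h : R -> R) :
  measurable_fun (`[0, 1[ : set R) f -> measurable_fun (`[0, 1[ : set R) g ->
  measurable_fun (`[0, 1[ : set R) h ->
  (forall x, h x = f x + g x) ->
  (\int[lebesgue_measure]_(x in `[0%R, 1%R[) (h x ^+ 2)%:E <=
   2%:E * \int[lebesgue_measure]_(x in `[0%R, 1%R[) (f x ^+ 2)%:E +
   2%:E * \int[lebesgue_measure]_(x in `[0%R, 1%R[) (g x ^+ 2)%:E)%E.
Proof.
move=> mf mg mh hfg.
have mE (k : R -> R) : measurable_fun (`[0, 1[ : set R) k ->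
    measurable_fun (`[0, 1[ : set R) (fun x => (k x ^+ 2)%:E).
  by move=> mk; apply/measurable_EFinP; exact: measurable_funX.
rewrite -!ge0_integralZl//; try exact: mE.
- rewrite -ge0_integralD//; last first.
  + by apply: emeasurable_funM => //; exact: mE.
  + by move=> x _; rewrite -EFinM lee_fin mulr_ge0// sqr_ge0.
  + by apply: emeasurable_funM => //; exact: mE.
  + by move=> x _; rewrite -EFinM lee_fin mulr_ge0// sqr_ge0.
  apply: ge0_le_integral => //.
  + by move=> x _; rewrite lee_fin sqr_ge0.
  + exact: mE.
  + by apply: emeasurable_funD; apply: emeasurable_funM => //; exact: mE.
  + move=> x _; rewrite -!EFinM -EFinD lee_fin hfg.
    by have := sqr_ge0 (f x - g x); rewrite !expr2; lra.
- by move=> x _; rewrite lee_fin sqr_ge0.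
- by move=> x _; rewrite lee_fin sqr_ge0.
Qed.

Lemma l2_approx_ext (R : realType) (phi : nat -> R -> R) u v :
  (forall x, 0 <= x < 1 -> u x = v x) -> l2_approx phi u -> l2_approx phi v.
Proof.
move=> uv [mu Hu]; split.
  apply: eq_measurable_fun mu => x; rewrite inE/= in_itv/= => x01; exact: uv.
move=> e /Hu[n [c h]]; exists n, c; apply: le_lt_trans h.
rewrite le_eqVlt; apply/orP; left; apply/eqP; apply: eq_integral => x.
by rewrite inE/= in_itv/= => /uv ->.
Qed.

Lemma l2_approx_base (R : realType) (phi : nat -> R -> R) k :
  measurable_fun (`[0, 1[ : set R) (phi k) -> l2_approx phi (phi k).
Proof.
move=> mk; split=> // e e0; exists k.+1, (fun i => (i == k)%:R).
rewrite integral0_eq// => x _.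
rewrite /lincomb big_ord_recr/= big1 ?eqxx ?mul1r ?add0r ?subrr ?expr0n//.
by move=> i _; rewrite ltn_eqF// mul0r.
Qed.

Lemma l2_approxD (R : realType) (phi : nat -> R -> R) u v :
  (forall k, measurable_fun (`[0, 1[ : set R) (phi k)) ->
  l2_approx phi u -> l2_approx phi v -> l2_approx phi (fun x => u x + v x).
Proof.
move=> mphi [mu Hu] [mv Hv]; split; first exact: measurable_funD.
move=> e e0; have e4 : 0 < e / 4 by lra.
have [n [c hc]] := Hu _ e4; have [m [d hd]] := Hv _ e4.
have [b hb] := lincombD phi n m c d; exists (maxn n m), b.
have mc := measurable_lincomb n c mphi; have md := measurable_lincomb m d mphi.
apply: le_lt_trans (integral_sqr_le (f := fun x => u x - lincomb phi n c x)
  (g := fun x => v x - lincomb phi m d x) _ _ _ _) _.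
- exact: measurable_funB.
- exact: measurable_funB.
- apply: measurable_funB; first exact: measurable_funD.
  exact: measurable_lincomb.
- by move=> x; rewrite -hb; ring.
have -> : e%:E = (2%:E * (e / 4)%:E + 2%:E * (e / 4)%:E)%E.
  by rewrite -!EFinM -EFinD; congr EFin; lra.
by apply: lteD; rewrite lte_pmul2l.
Qed.

Lemma l2_approxZ (R : realType) (phi : nat -> R -> R) a u :
  (forall k, measurable_fun (`[0, 1[ : set R) (phi k)) ->
  l2_approx phi u -> l2_approx phi (fun x => a * u x).
Proof.
move=> mphi [mu Hu]; split; first exact: measurable_funM.
move=> e e0; have a2 : 0 < a ^+ 2 + 1 by have := sqr_ge0 a; lra.
have [n [c hc]] := Hu (e / (a ^+ 2 + 1)) (divr_gt0 e0 a2).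
exists n, (fun k => a * c k).
have mc := measurable_lincomb n c mphi.
rewrite (_ : (fun x => _) =
    (fun x => (a ^+ 2)%:E * ((u x - lincomb phi n c x) ^+ 2)%:E)%E); last first.
  apply/funext => x; rewrite -EFinM -exprMn; congr (_ ^+ 2)%:E.
  rewrite mulrBr; congr (_ - _); rewrite /lincomb mulr_sumr.
  by apply: eq_bigr => k _; rewrite mulrA.
rewrite ge0_integralZl//; last first.
- by rewrite lee_fin sqr_ge0.
- by move=> x _; rewrite lee_fin sqr_ge0.
- by apply/measurable_EFinP/measurable_funX; exact: measurable_funB.
set I := (\int[_]_(x in _) _)%E in hc *.
apply: (@le_lt_trans _ _ ((a ^+ 2 + 1)%:E * I)%E).
  apply: lee_wpmul2r; last by rewrite lee_fin lerDl.
  by apply: integral_ge0 => x _; rewrite lee_fin sqr_ge0.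
have -> : e%:E = ((a ^+ 2 + 1)%:E * (e / (a ^+ 2 + 1))%:E)%E.
  by rewrite -EFinM mulrCA divff ?gt_eqF// mulr1.
by rewrite lte_pmul2l.
Qed.

(** Closure under pointwise limits dominated by a square integrable
    function. *)
Lemma l2_approx_cvg (R : realType) (phi : nat -> R -> R)
    (u_ : nat -> R -> R) (u h : R -> R) :
  (forall k, measurable_fun (`[0, 1[ : set R) (phi k)) ->
  (forall n, l2_approx phi (u_ n)) ->
  measurable_fun (`[0, 1[ : set R) u ->
  (forall x, 0 <= x < 1 -> u_ n x @[n --> \oo] --> u x) ->
  lebesgue_measure.-integrable (`[0, 1[ : set R) (fun x => (h x ^+ 2)%:E) ->
  (forall n x, 0 <= x < 1 -> `|u_ n x| <= h x) ->
  (forall x, 0 <= x < 1 -> `|u x| <= h x) ->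
  l2_approx phi u.
Proof.
move=> mphi Hu mu cu ih bu_ bu; split=> // e e0; have e4 : 0 < e / 4 by lra.
have muk k : measurable_fun (`[0, 1[ : set R) (u_ k) by have [] := Hu k.
have mf_ n : measurable_fun (`[0, 1[ : set R) (fun x => ((u x - u_ n x) ^+ 2)%:E).
  by apply/measurable_EFinP/measurable_funX; exact: measurable_funB.
have cf x : 0 <= x < 1 -> ((u x - u_ n x) ^+ 2)%:E @[n --> \oo] --> 0%E.
  move=> /cu cx; apply: cvg_EFin; first exact: nearW.
  rewrite (_ : 0 = (u x - u x) * (u x - u x)); last by rewrite subrr mul0r.
  rewrite (_ : fine \o _ = (fun n => (u x - u_ n x) * (u x - u_ n x))); last first.
    by apply/funext => n /=; rewrite expr2.
  by apply: cvgM; apply: cvgB => //; exact: cvg_cst.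
have ig : lebesgue_measure.-integrable (`[0, 1[ : set R)
    (fun x => 4%:E * (h x ^+ 2)%:E)%E by exact: integrableZl.
have fg n x : 0 <= x < 1 -> (`|((u x - u_ n x) ^+ 2)%:E| <= 4%:E * (h x ^+ 2)%:E)%E.
  move=> x01; rewrite abse_EFin ger0_norm ?sqr_ge0// -EFinM lee_fin.
  rewrite -(ger0_norm (sqr_ge0 _)) normrX.
  rewrite (_ : 4 * h x ^+ 2 = (h x + h x) ^+ 2); last by ring.
  rewrite lerXn2r ?nnegrE ?addr_ge0 ?(le_trans _ (bu x x01))//.
  by rewrite (le_trans (ler_normB _ _))// lerD ?bu ?bu_.
have cf' : {ae lebesgue_measure, forall x, (`[0, 1[%classic : set R) x ->
    ((u x - u_ n x) ^+ 2)%:E @[n --> \oo] --> 0%E}.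
  by apply: aeW => x /=; rewrite in_itv/= => /cf.
have fg' : {ae lebesgue_measure, forall x n, (`[0, 1[%classic : set R) x ->
    (`|((u x - u_ n x) ^+ 2)%:E| <= 4%:E * (h x ^+ 2)%:E)%E}.
  by apply: aeW => x n /=; rewrite in_itv/= => /(fg n).
have [_ _] := @dominated_convergence _ _ _ (@lebesgue_measure R)
  `[0, 1[%classic (measurable_itv _) _ (cst 0%E) _ mf_ (measurable_cst _)
  cf' ig fg'.
rewrite integral_cst// mul0e => /fine_cvgP[fin cv].
have : \forall n \near \oo, (\int[lebesgue_measure]_(x in `[0%R, 1%R[)
    ((u x - u_ n x) ^+ 2)%:E < (e / 4)%:E)%E.
  near=> n; rewrite -[ltLHS]fineK; last by near: n; exact: fin.
  rewrite lte_fin; near: n; exact: (cvgr_lt _ cv).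
case=> n _ /(_ n (leqnn n)) hn.
have [_ /(_ _ e4)[m [c hc]]] := Hu n; exists m, c.
have mc := measurable_lincomb m c mphi.
apply: le_lt_trans (integral_sqr_le (f := fun x => u x - u_ n x)
  (g := fun x => u_ n x - lincomb phi m c x) _ _ _ _) _.
- exact: measurable_funB.
- exact: measurable_funB.
- exact: measurable_funB.
- by move=> x; ring.
have -> : e%:E = (2%:E * (e / 4)%:E + 2%:E * (e / 4)%:E)%E.
  by rewrite -!EFinM -EFinD; congr EFin; lra.
by apply: lteD; rewrite lte_pmul2l.
Unshelve. all: by end_near. Qed.

Lemma l2_approx0 (R : realType) (phi : nat -> R -> R) : l2_approx phi (cst 0).
Proof.
split=> // e e0; exists 0%N, (cst 0).
by rewrite integral0_eq// => x _; rewrite /lincomb big_ord0 subrr expr0n.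
Qed.

Lemma l2_approx_sum (R : realType) (phi : nat -> R -> R) n (u : nat -> R -> R) :
  (forall k, measurable_fun (`[0, 1[ : set R) (phi k)) ->
  (forall i, (i < n)%N -> l2_approx phi (u i)) ->
  l2_approx phi (fun x => \sum_(i < n) u i x).
Proof.
move=> mphi; elim: n => [|n IH] Hu.
  by apply: l2_approx_ext (l2_approx0 phi) => x _; rewrite big_ord0.
apply: l2_approx_ext (l2_approxD mphi (IH _) (Hu n (ltnSn n))) => [x _|i ni].
  by rewrite big_ord_recr.
by apply: Hu; rewrite ltnS ltnW.
Qed.

Lemma integrable_sqr1 (R : realType) :
  (@lebesgue_measure R).-integrable (`[0, 1[ : set R) (fun x => (1 ^+ 2)%:E).
Proof.
apply/integrableP; split => //.
rewrite integral_cst//= lebesgue_measure_itv/= lte_fin ltr01.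
by rewrite expr1n normr1 mul1e -EFinB ltry.
Qed.

(** Each half of a dyadic interval has for indicator a combination of the
    indicator of the interval and of its wavelet. *)
Lemma l2_approx_cell (R : realType) (phi : nat -> R -> R) :
  (forall k, measurable_fun (`[0, 1[ : set R) (phi k)) ->
  (forall m, l2_approx phi (haar m)) ->
  forall j k, (k < 2 ^ j)%N -> l2_approx phi (dyadic_cell j k).
Proof.
move=> mphi Hh; elim=> [|j IH] k kj.
  by move: kj; rewrite expn0 ltnS leqn0 => /eqP ->; exact: (Hh 0%N).
have k2 : (k./2 < 2 ^ j)%N.
  by move: kj; rewrite expnS; have := odd_double_half k; case: odd; lia.
have Hw := Hh (2 ^ j + k./2)%N; rewrite (haarE R k2) in Hw.
(* The cell [k] of level [j.+1] is the right half of its parent when [k] is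
   odd. *)
set s : R := if odd k then -1 else 1.
have := l2_approxD mphi (l2_approxZ 2^-1 mphi (IH _ k2))
  (l2_approxZ (s / 2 / Num.sqrt (2 ^+ j)) mphi Hw).
apply: l2_approx_ext => x /andP[x0 _].
rewrite haar_waveletE// !dyadic_cellE// (digits_half j x0).
have sq0 : Num.sqrt (2 ^+ j) != 0 :> R by rewrite gt_eqF// sqrtr_gt0 exprn_gt0.
set t := (X in _ * (_ * X)); rewrite (_ : _ * (_ * t) = s / 2 * t); last by field.
rewrite {}/t {}/s; have := odd_double_half k; have := odd_double_half (digits j.+1 x).
move: (digits j.+1 x) => d; set q := d./2; set r := k./2 => <- <-.
rewrite -[X in _ == X.+1](add0n r.*2) -addSn.
rewrite (_ : (odd d + q.*2 == r.*2)%N = (odd d + q.*2 == false + r.*2)%N)//.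
have [->|qr] := eqVneq q r.
  by rewrite !eqn_add2r; case: (odd d); case: (odd k);
    rewrite /= add0n odd_double /=; lra.
have qr2 (a b : bool) : (a + q.*2 == b + r.*2)%N = false.
  by apply/negbTE/eqP; move/eqP: qr; case: a; case: b => /=; lia.
by rewrite (qr2 _ false) (qr2 _ true) qr2 subrr !mulr0 addr0.
Qed.

(** A ray is, on [0, 1[, the limit of the rays ending at the dyadic
    truncations of [b]. *)
Lemma l2_approx_ray (R : realType) (phi : nat -> R -> R) (b : R) :
  (forall k, measurable_fun (`[0, 1[ : set R) (phi k)) ->
  (forall j k, (k < 2 ^ j)%N -> l2_approx phi (dyadic_cell j k)) ->
  l2_approx phi (\1_(`]-oo, b[%classic : set R)).
Proof.
move=> mphi Hc.
have iE (x : R) : \1_(`]-oo, b[%classic : set R) x = (x < b)%R%:R :> R.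
  by rewrite indicE mem_setE in_itv.
have [b1|b1] := leP 1 b.
  apply: l2_approx_ext (Hc 0%N 0%N isT) => x x01; rewrite dyadic_cellE.
    by rewrite digits0// iE; case/andP: x01 => _ /lt_le_trans ->.
  by case/andP: x01.
have [b0|b0] := leP b 0.
  apply: l2_approx_ext (l2_approx0 phi) => x /andP[x0 _].
  by rewrite iE ltNge (le_trans b0 x0).
pose t n := digits n b.
have uE n x : 0 <= x < 1 ->
    \sum_(k < t n) dyadic_cell n k x = (digits n x < t n)%:R :> R.
  move=> /andP[x0 _]; under eq_bigr do rewrite dyadic_cellE//.
  have [h|h] := ltnP.
    rewrite (bigD1 (Ordinal h))//= eqxx big1 ?addr0// => i.
    by rewrite -val_eqE/= eq_sym => /negbTE ->.
  by rewrite big1// => i _; rewrite gtn_eqF// (leq_trans _ h).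
apply: (@l2_approx_cvg _ _ (fun n x => \sum_(k < t n) dyadic_cell n k x)
  _ (cst 1)) => //.
- move=> n; apply: l2_approx_sum => // k kn; apply: Hc; apply: ltn_trans kn _.
  by rewrite digits_lt// ltW.
- move=> x x01; apply: cvg_near_cst; under eq_near do rewrite uE//.
  have x0 : 0 <= x by case/andP: x01.
  rewrite iE; have [xb|bx] := ltP x b; last first.
    apply: nearW => n; rewrite ltnNge /t /digits le_truncn//.
    by rewrite ler_wpM2l// exprn_ge0.
  (* Once [1 / (b - x) <= 2 ^ n], a point of the grid of level [n] separates
     [x] from [b]. *)
  near=> n; suff -> : (digits n x < t n)%N by [].
  have xt : (digits n x)%:R <= 2 ^+ n * x by rewrite truncn_le mulr_ge0 ?exprn_ge0.
  rewrite /t /digits truncn_ge_nat ?mulr_ge0 ?exprn_ge0 ?(ltW b0)//.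
  rewrite -natr1; apply: (@le_trans _ _ (2 ^+ n * x + 1)); first by rewrite lerD2r.
  rewrite -lerBrDl -mulrBr -ler_pdivrMr ?subr_gt0// mul1r.
  apply: (@le_trans _ _ n%:R); last by rewrite -natrX ler_nat ltnW// ltn_expl.
  by near: n; exact: nbhs_infty_ger.
- exact: integrable_sqr1.
- by move=> n x /uE ->; rewrite normr_nat; case: (_ < _)%N.
- by move=> x _; rewrite iE normr_nat; case: (_ < _).
Unshelve. all: by end_near. Qed.

(** Borel sets are generated by the pi-system of rays. *)
Lemma l2_approx_indic (R : realType) (phi : nat -> R -> R) (S : set R) :
  (forall k, measurable_fun (`[0, 1[ : set R) (phi k)) ->
  (forall j k, (k < 2 ^ j)%N -> l2_approx phi (dyadic_cell j k)) ->
  measurable S -> l2_approx phi \1_S.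
Proof.
move=> mphi Hc mS; have mE := RGenInftyO.measurableE R.
apply: (@dynkin_induction _ R (@RGenInftyO.G R) (fun S => l2_approx phi \1_S)) => //.
- move=> _ _ [x ->] [y ->]; exists (Num.min x y); apply/seteqP; split => z /=.
    by rewrite !in_itv/= lt_min => -[-> ->].
  by rewrite !in_itv/= lt_min => /andP[].
- apply: l2_approx_ext (Hc 0%N 0%N isT) => x x01; rewrite dyadic_cellE.
    by rewrite digits0// indicT.
  by case/andP: x01.
- by move=> _ [x ->]; exact: l2_approx_ray.
- move=> A _ HA.
  have := l2_approxD mphi (Hc 0%N 0%N isT) (l2_approxZ (-1) mphi HA).
  apply: l2_approx_ext => x x01; rewrite dyadic_cellE; last by case/andP: x01.
  rewrite digits0// !indicE in_setC; case: (x \in A) => /=; ring.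
- move=> F mF tF HF.
  have uE n i x : F i x -> \sum_(k < n) \1_(F k) x = (i < n)%:R :> R.
    move=> Fix; have Fk (k : 'I_n) : k != i :> nat -> \1_(F k) x = 0 :> R.
      move=> ki; rewrite indicE memNset// => Fkx; move/eqP: ki; apply.
      by apply: (tF k i I I); exists x.
    have [h|h] := ltnP.
      rewrite (bigD1 (Ordinal h))//= indicE mem_set// big1 ?addr0// => k /Fk.
    by rewrite big1// => k _; apply: Fk; rewrite ltn_eqF// (leq_trans _ h).
  have u0 n x : ~ (\bigcup_k F k) x -> \sum_(k < n) \1_(F k) x = 0 :> R.
    move=> Fx; rewrite big1// => k _; rewrite indicE memNset// => Fkx.
    by apply: Fx; exists k.
  apply: (@l2_approx_cvg _ _ (fun n x => \sum_(k < n) \1_(F k) x) _ (cst 1)) => //.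
  + by move=> n; apply: (@l2_approx_sum _ _ _ (fun k => \1_(F k))).
  + by apply: measurable_indic; exact: bigcup_measurable.
  + move=> x _; apply: cvg_near_cst.
    have [[i _ Fix]|nF] := pselect ((\bigcup_k F k) x); last first.
      by apply: nearW => n; rewrite u0// indicE memNset.
    exists i.+1 => // n /= ni; rewrite (uE n i)// ni indicE mem_set//.
    by exists i.
  + exact: integrable_sqr1.
  + move=> n x _; have [[i _ Fix]|nF] := pselect ((\bigcup_k F k) x).
      by rewrite (uE n i)// normr_nat; case: (_ < _)%N.
    by rewrite u0// normr0 ler01.
  + by move=> x _; rewrite indicE normr_nat; case: (_ \in _).
- by have : (@ocitv R).-sigma.-measurable S by []; rewrite mE.
Qed.

Import HBNNSimple.

Lemma l2_approx_ge0 (R : realType) (phi : nat -> R -> R) (u : R -> R) :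
  (forall k, measurable_fun (`[0, 1[ : set R) (phi k)) ->
  (forall j k, (k < 2 ^ j)%N -> l2_approx phi (dyadic_cell j k)) ->
  measurable_fun (`[0, 1[ : set R) u -> (forall x, 0 <= x < 1 -> 0 <= u x) ->
  lebesgue_measure.-integrable (`[0, 1[ : set R) (fun x => (u x ^+ 2)%:E) ->
  l2_approx phi u.
Proof.
move=> mphi Hc mu u0 iu.
have [||g [ndg cg]] := @approximation _ _ R (`[0, 1[%classic : set R) (measurable_itv _)
  (EFin \o u).
- exact/measurable_EFinP.
- by move=> x /=; rewrite in_itv/= lee_fin => /u0.
have cg' x : 0 <= x < 1 -> g n x @[n --> \oo] --> u x.
  move=> x01; have /cg /fine_cvgP[_] : (`[0, 1[%classic : set R) x by rewrite /= in_itv.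
  by [].
apply: (@l2_approx_cvg _ _ (fun n x => g n x) _ u) => //.
- move=> n; pose s := finmap.enum_fset (fset_set (range (g n))).
  apply: (@l2_approx_ext _ _ (fun x => \sum_(i < size s) s`_i * \1_(g n @^-1` [set s`_i]) x)).
    by move=> x _; rewrite fimfunEord.
  apply: (@l2_approx_sum _ _ _ (fun i x => s`_i * \1_(g n @^-1` [set s`_i]) x)) => // i _.
  apply: l2_approxZ => //; apply: l2_approx_indic => //.
- move=> n x x01; rewrite ger0_norm//.
  have := @nondecreasing_cvgn_le _ (fun n => g n x) _ (cvgP _ (cg' x x01)) n.
  rewrite (cvg_lim _ (cg' x x01))//; apply => //.
  by move=> p q pq; have /lefP := ndg _ _ pq; exact.
- by move=> x /u0 ux; rewrite ger0_norm.
Qed.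

(** If every Haar function is a limit of linear combinations of [phi], then so
    is every square integrable function. *)
Theorem l2_approx_dense (R : realType) (phi : nat -> R -> R) (u : R -> R) :
  (forall k, measurable_fun (`[0, 1[ : set R) (phi k)) ->
  (forall m, l2_approx phi (haar m)) ->
  measurable_fun (`[0, 1[ : set R) u ->
  lebesgue_measure.-integrable (`[0, 1[ : set R) (fun x => (u x ^+ 2)%:E) ->
  l2_approx phi u.
Proof.
move=> mphi /(l2_approx_cell mphi) Hc mu iu.
have part (v : R -> R) : measurable_fun (`[0, 1[ : set R) v ->
    (forall x, v x ^+ 2 = u x ^+ 2) -> l2_approx phi (fun x => Num.max (v x) 0).
  move=> mv vu.
  have mm : measurable_fun (`[0, 1[ : set R) (fun x => Num.max (v x) 0).
    by apply: measurable_maxr.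
  apply: l2_approx_ge0 => //.
    by move=> x _; rewrite le_max lexx orbT.
  apply: le_integrable iu => //.
    by apply/measurable_EFinP/measurable_funX.
  move=> x _; rewrite !abse_EFin lee_fin !ger0_norm ?sqr_ge0// -vu.
  by case: (leP (v x) 0) => _; rewrite ?lexx ?expr0n ?sqr_ge0.
have mNu : measurable_fun (`[0, 1[ : set R) (fun x => - u x) by exact: measurableT_comp.
have := l2_approxD mphi (part u mu (fun=> erefl))
  (l2_approxZ (-1) mphi (part (fun x => - u x) mNu (fun x => sqrrN (u x)))).
by apply: l2_approx_ext => x _; case: (leP (u x) 0); case: (leP (- u x) 0); lra.
Qed.

(** * Norms *)

Lemma L2normE (R : realType) (g : R -> R) : L2norm g =
  ((\int[lebesgue_measure]_(x in `[0%R, 1%R]) (g x ^+ 2)%:E) `^ 2^-1)%E.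
Proof.
rewrite /L2norm unlock /Lnorm; congr (_ `^ _)%E.
rewrite [RHS]integral_mkcond; apply: eq_integral => x _.
rewrite !patchE; case: ifP => _ /=.
  by rewrite powR_mulrn// -normrX ger0_norm// sqr_ge0.
by rewrite normr0 powR0.
Qed.

Lemma L2norm_le (R : realType) (g : R -> R) (y : R) : 0 <= y ->
  (\int[lebesgue_measure]_(x in `[0%R, 1%R]) (g x ^+ 2)%:E <= (y ^+ 2)%:E)%E ->
  (L2norm g <= y%:E)%E.
Proof.
move=> y0 h; rewrite L2normE; apply: (@le_trans _ _ ((y ^+ 2)%:E `^ 2^-1)%E).
  apply: gt0_ler_poweR => //; rewrite in_itv/= ?leey ?andbT ?lee_fin ?sqr_ge0//.
  by apply: integral_ge0 => x _; rewrite lee_fin sqr_ge0.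
by rewrite poweR_EFin powR12_sqrt ?sqr_ge0// sqrtr_sqr ger0_norm.
Qed.

(** Monotonicity of the integral of nonnegative functions, without any
    measurability: both integrals are suprema over simple functions. *)
Lemma ge0_le_integralW d (T : measurableType d) (R : realType)
    (mu : {measure set T -> \bar R}) (D : set T) (f g : T -> \bar R) :
  (forall x, D x -> (0 <= f x)%E) -> (forall x, D x -> (f x <= g x)%E) ->
  (\int[mu]_(x in D) f x <= \int[mu]_(x in D) g x)%E.
Proof.
move=> f0 fg; rewrite !ge0_integralE//; last first.
  by move=> x Dx; rewrite (le_trans (f0 x Dx))// fg.
apply: ereal_sup_le => _ [h /= hf <-]; exists h => //= x.
apply: le_trans (hf x) _; rewrite !patchE; case: ifPn => // /set_mem; exact: fg.
Qed.

Lemma normc_sqr (R : realType) (z : R[i]) :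
  Normc.normc z ^+ 2 = complex.Re z ^+ 2 + complex.Im z ^+ 2.
Proof. by case: z => a b; rewrite /= sqr_sqrtr// addr_ge0 ?sqr_ge0. Qed.

Lemma normc_ge0 (R : realType) (z : R[i]) : 0 <= Normc.normc z.
Proof. by case: z => a b; rewrite /= sqrtr_ge0. Qed.

Lemma normc_sum (R : realType) (I : Type) (r : seq I) (P : pred I) (b : I -> R[i]) :
  Normc.normc (\sum_(i <- r | P i) b i) <= \sum_(i <- r | P i) Normc.normc (b i).
Proof.
elim/big_ind2: _ => [|x1 y1 x2 y2 h1 h2|//]; first by rewrite Normc.normc0.
by apply: le_trans (le_normcD _ _) _; exact: lerD.
Qed.

Lemma sqr_sum_le_card (R : realType) (I : finType) (A : {set I}) (r : I -> R) :
  (\sum_(i in A) r i) ^+ 2 <= #|A|%:R * \sum_(i in A) r i ^+ 2.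
Proof.
set s := \sum_(i in A) r i; set q := \sum_(i in A) _; set c : R := #|A|%:R.
have [/eqP|A0] := posnP #|A|.
  rewrite finset.cards_eq0 => /eqP A0; rewrite /s A0 finset.big_set0 expr0n.
  by apply: mulr_ge0 => //; apply: sumr_ge0 => i _; exact: sqr_ge0.
have c0 : 0 < c by rewrite ltr0n.
have : 0 <= \sum_(i in A) (c * r i - s) ^+ 2 by apply: sumr_ge0 => i _; exact: sqr_ge0.
have -> : \sum_(i in A) (c * r i - s) ^+ 2 = c ^+ 2 * q - c * 2 * s * s + c * s ^+ 2.
  rewrite (eq_bigr (fun i => c ^+ 2 * r i ^+ 2 + (- (c * 2 * s)) * r i + s ^+ 2)).
    rewrite !big_split/= -!mulr_sumr sumr_const -[s *+ _]mulr_natr -/s -/q -/c; ring.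
  by move=> i _; ring.
by move=> h; rewrite -(ler_pM2l c0); lra.
Qed.

(** A sequence with few nonzero terms has a V^2 norm controlled by its l^2
    norm. *)
Lemma V2norm_le (R : realType) N (b : 'I_N -> R[i]) (M : nat) :
  (#|[set n | (b n != 0)%R]%SET| <= M)%N ->
  V2norm b ^+ 2 <= M%:R * \sum_(n < N) Normc.normc (b n) ^+ 2.
Proof.
set S := [set n | (b n != 0)%R]%SET => SM.
have s0 : 0 <= M%:R * \sum_(n < N) Normc.normc (b n) ^+ 2.
  by rewrite mulr_ge0// sumr_ge0// => n _; rewrite sqr_ge0.
suff h : V2norm b <= Num.sqrt (M%:R * \sum_(n < N) Normc.normc (b n) ^+ 2).
  rewrite -[leRHS](sqr_sqrtr s0) lerXn2r ?nnegrE ?sqrtr_ge0//.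
  by rewrite /V2norm; elim/big_ind: _ => // x y x0 y0; rewrite le_max x0.
apply: bigmax_le => [|P /andP[/and3P[/eqP cP tP _] _]]; first exact: sqrtr_ge0.
apply: ler_wsqrtr; rewrite [X in M%:R * X](_ : _ =
    \sum_(n in finset.cover P) Normc.normc (b n) ^+ 2); last first.
  by rewrite cP; apply: eq_bigl => n; rewrite finset.in_setT.
rewrite (finset.big_trivIset _ tP)/= mulr_sumr; apply: ler_sum => I _.
have -> : \sum_(n in I) b n = \sum_(n in (I :&: S)%SET) b n.
  rewrite [LHS](big_setID S)/= [X in _ + X]big1 ?addr0// => n.
  by rewrite !finset.inE negbK => /andP[/eqP].
apply: (@le_trans _ _ ((\sum_(n in (I :&: S)%SET) Normc.normc (b n)) ^+ 2)).
  by rewrite lerXn2r ?nnegrE ?normc_ge0 ?normc_sum// sumr_ge0// => n _; exact: normc_ge0.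
apply: le_trans (sqr_sum_le_card _ _) _; apply: ler_pM => //.
- by apply: sumr_ge0 => n _; exact: sqr_ge0.
- by rewrite ler_nat (leq_trans _ SM)// subset_leq_card// finset.subsetIr.
- rewrite [leRHS](big_setID S)/= lerDl sumr_ge0// => n _; exact: sqr_ge0.
Qed.

(** * Rearrangement of the basis *)

(** There is a bijection of the natural numbers that agrees with a given
    injection [g] outside of the range of a given injection [p]: send [p k]
    to [k] when [k] is not in the range of [g], and [p (g j)] to the value
    [g (p j)] which is not taken at the position [p j]. *)
Lemma interleave_bijection (p g : nat -> nat) : injective p -> injective g ->
  exists s : nat -> nat, [/\ injective s, forall m, exists n, s n = m &
    forall n, (forall k, p k <> n) -> s n = g n].
Proof.
move=> pI gI.
pose spec n m := ((forall k, p k <> n) /\ m = g n) \/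
  (exists k, p k = n /\ ((forall j, g j <> k) /\ m = k \/
                         exists j, g j = k /\ m = g (p j))).
have [s hs] : {s : nat -> nat & forall n, spec n (s n)}.
  apply: boolp.choice => n.
  have [[k pk]|np] := pselect (exists k, p k = n); last first.
    by exists (g n); left; split => // k pk; apply: np; exists k.
  have [[j gj]|ng] := pselect (exists j, g j = k); last first.
    exists k; right; exists k; split => //; left; split => // j gj.
    by apply: ng; exists j.
  by exists (g (p j)); right; exists k; split => //; right; exists j.
have spec_fun n m m' : spec n m -> spec n m' -> m = m'.
  move=> [[np ->]|[k [pk h]]] [[np' ->]|[k' [pk' h']]] //.
  - by case: (np k').
  - by case: (np' k).
  - have kk : k = k' by apply: pI; rewrite pk pk'.
    move: h h'; rewrite -kk => -[[ng ->]|[j [gj ->]]] [[ng' ->]|[j' [gj' ->]]] //.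
    + by case: (ng j').
    + by case: (ng' j).
    + by rewrite (gI j j') // gj gj'.
have spec_inj n n' m : spec n m -> spec n' m -> n = n'.
  move=> [[np e]|[k [pk [[ng e]|[j [gj e]]]]]]
         [[np' e']|[k' [pk' [[ng' e']|[j' [gj' e']]]]]].
  - by apply: gI; rewrite -e -e'.
  - by case: (ng' n); rewrite -e -e'.
  - by case: (np j'); apply: gI; rewrite -e -e'.
  - by case: (ng n'); rewrite -e -e'.
  - by rewrite -pk -pk' -e -e'.
  - by case: (ng (p j')); rewrite -e -e'.
  - by case: (np' j); apply: gI; rewrite -e -e'.
  - by case: (ng' (p j)); rewrite -e -e'.
  - by rewrite -pk -pk' -gj -gj' (pI j j')//; apply: gI; rewrite -e -e'.
exists s; split.
- by move=> n n' e; apply: (spec_inj _ _ (s n)) => //; rewrite e.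
- move=> m; have [[j gj]|ng] := pselect (exists j, g j = m); last first.
    exists (p m); apply: (spec_fun (p m)) => //; right; exists m; split=> //.
    by left; split => // j gj; apply: ng; exists j.
  have [[i pi]|np] := pselect (exists i, p i = j); last first.
    exists j; apply: (spec_fun j) => //; left; split => // k pk.
    by apply: np; exists k.
  exists (p (g i)); apply: (spec_fun (p (g i))) => //; right; exists (g i).
  by split => //; right; exists i; split => //; rewrite pi gj.
- by move=> n np; apply: (spec_fun n) => //; left.
Qed.

Lemma sparse_sequence (R : realType) (w : nat -> R) :
  (forall m n : nat, (m <= n)%N -> w m <= w n) -> w n @[n --> \oo] --> +oo ->
  exists p : nat -> nat, (forall i j : nat, (i < j)%N -> (p i < p j)%N) /\
    forall k, k.+2%:R <= w (p k).
Proof.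
move=> mw winf.
have [q hq] : {q : nat -> nat & forall k, k.+2%:R <= w (q k)}.
  apply: (@boolp.choice _ _ (fun k n => k.+2%:R <= w n)) => k.
  by have /cvgryPge /(_ k.+2%:R) [n _ /(_ n (leqnn n))] := winf; exists n.
exists (fun k => \sum_(i < k.+1) (q i).+1)%N; split; last first.
  by move=> k; apply: le_trans (hq k) (mw _ _ _); rewrite big_ord_recr/=; lia.
apply: (@homo_ltn _ _ (fun i j => (i < j)%N)); first exact: ltn_trans.
by move=> k; rewrite [ltnRHS]big_ord_recr/=; lia.
Qed.

(** The index of the wavelet of level [n.+1] supported in the dyadic interval
    [2^-(n+1), 2^-n[. *)
Definition separated_index (n : nat) : nat := (2 ^ n.+1 + 1)%N.

Lemma separated_index_inj : injective separated_index.
Proof. by move=> m n /addIn /expnI => /(_ isT) []. Qed.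

Lemma separated_support (R : realType) m n (x : R) : 0 <= x ->
  haar (separated_index m) x != 0 -> haar (separated_index n) x != 0 -> m = n.
Proof.
move=> x0; wlog mn : m n / (m < n)%N => [hw hm hn|].
  by case: (ltngtP m n) => // h; [exact: hw|apply/esym; exact: hw].
have lt2 k : (1 < 2 ^ k.+1)%N by rewrite -{1}(expn0 2) ltn_exp2l.
rewrite /separated_index !haarE// => /(haar_wavelet_support x0) hm.
move=> /(haar_wavelet_support x0) hn.
move: hm; rewrite (digits_div (n - m)%N)// addSn subnKC ?(ltnW mn)// hn divn_small//.
by rewrite -subnSK.
Qed.

(** As soon as [N] exceeds [p 0], the number of nonzero functions among the
    first [N] is at most [w N] at every point. *)
Lemma active_card (R : realType) (w : nat -> R) (p s : nat -> nat) (N : nat)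
    (x : R) :
  (forall m n : nat, (m <= n)%N -> w m <= w n) ->
  (forall i j : nat, (i < j)%N -> (p i < p j)%N) ->
  (forall k, k.+2%:R <= w (p k)) ->
  (forall n, (forall k, p k <> n) -> s n = separated_index n) ->
  (p 0 < N)%N -> 0 <= x ->
  exists2 M : nat, M%:R <= w N &
    (#|[set n : 'I_N | (haar (s n) x != 0)%R]%SET| <= M)%N.
Proof.
move=> mw mp wp sE p0 x0.
have ple k : (k <= p k)%N.
  by elim: k => // k IH; apply: leq_ltn_trans IH (mp _ _ _).
have [M NM Mmin] : exists2 M, (N <= p M)%N & forall k, (k < M)%N -> (p k < N)%N.
  have exM : exists M, (N <= p M)%N by exists N.
  exists (ex_minn exM); first by case: ex_minnP.
  by case: ex_minnP => M _ hM k kM; rewrite ltnNge; apply/negP => /hM; rewrite leqNgt kM.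
have M0 : (0 < M)%N by case: M NM {Mmin} => //; rewrite leqNgt p0.
(* [M] positions [p k] lie below [N], and at most one function of the disjoint
   family is nonzero at [x]. *)
exists M.+1.
  have := wp M.-1; rewrite prednK// => /le_trans; apply; apply: mw.
  by rewrite ltnW// Mmin// prednK.
pose bad := [set n : 'I_N | (nat_of_ord n \in [seq p k | k <- iota 0 M])]%SET.
pose good := [set n : 'I_N | (nat_of_ord n \notin [seq p k | k <- iota 0 M]) &&
   (haar (s n) x != 0)%R]%SET.
apply: (@leq_trans (#|(bad :|: good)%SET|)).
  apply: subset_leq_card; apply/fintype.subsetP => n; rewrite !finset.inE => ->.
  by rewrite andbT orbN.
apply: (@leq_trans (#|bad| + #|good|)); first by rewrite cardsU leq_subr.
rewrite -addn1; apply: leq_add.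
  rewrite cardE -(size_map (@nat_of_ord N)) -[leqRHS](size_iota 0) -[leqRHS](size_map p).
  apply: uniq_leq_size; first by rewrite (map_inj_uniq (@ord_inj _)) enum_uniq.
  by move=> _ /mapP[n nb ->]; move: nb; rewrite mem_enum finset.inE.
apply/card_le1_eqP => n n'; rewrite !finset.inE.
have np (i : 'I_N) : nat_of_ord i \notin [seq p k | k <- iota 0 M] -> forall k, p k <> i.
  move=> /mapP h k pk; apply: h; exists k => //; rewrite mem_iota add0n/= ltnNge.
  apply/negP => Mk; have := ltn_ord i; rewrite -pk ltnNge => /negP; apply.
  apply: leq_trans NM _; move: Mk; rewrite leq_eqVlt => /orP[/eqP ->//|/mp/ltnW//].
move=> /andP[/np h1 nz1] /andP[/np h2 nz2]; apply/val_inj => /=.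
by move: nz2 nz1; rewrite !sE//; exact: separated_support.
Qed.

(** * The rearranged system *)

Lemma integral_haar_sqr (R : realType) m :
  (\int[@lebesgue_measure R]_(x in `[0%R, 1%R]) (haar m x ^+ 2)%:E = 1)%E.
Proof.
rewrite -integral_itv_bndo_bndc; last first.
  by apply/measurable_EFinP/measurable_funX; exact: measurable_haar.
have := haar_orthonormal R m m; rewrite eqxx /Rintegral.
under eq_integral do rewrite -expr2.
by case: (\int[_]_(x in _) _)%E => [r /= ->||] //= /eqP; rewrite eq_sym oner_eq0.
Qed.

Lemma Re_real (R : realType) (x : R) : complex.Re (x%:C) = x. Proof. by []. Qed.

Lemma haar_orthonormal_system (R : realType) (s : nat -> nat) : injective s ->
  orthonormal_system (fun n x => (haar (s n) x)%:C : R[i]).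
Proof.
move=> sI; split=> [n|m n].
  split; [exact: measurable_haar|exact: measurable_cst|].
  apply: (@le_lt_trans _ _ 1%:E); last exact: ltry.
  apply: L2norm_le => //; rewrite expr1n.
  under eq_integral do rewrite normc_sqr/= expr0n addr0.
  by rewrite integral_haar_sqr.
have pE x : (haar (s m) x)%:C * ((haar (s n) x)%:C)^* =
    (haar (s m) x * haar (s n) x)%:C :> R[i].
  by rewrite [RHS]rmorphM; congr (_ * _); apply/eqP; rewrite eq_complex/= oppr0 !eqxx.
rewrite /L2inner; under eq_Rintegral do rewrite pE Re_real.
have -> : \int[@lebesgue_measure R]_(x in `[0, 1])
    (haar (s m) x * haar (s n) x) = (m == n)%:R.
  rewrite /Rintegral -integral_itv_bndo_bndc; last first.
    by apply/measurable_EFinP/measurable_funM; exact: measurable_haar.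
  by rewrite -[fine _]/(Rintegral _ _ _) haar_orthonormal (inj_eq sI).
have -> : \int[@lebesgue_measure R]_(x in `[0, 1])
   complex.Im ((haar (s m) x)%:C * ((haar (s n) x)%:C)^*) = 0.
  by under eq_Rintegral do rewrite pE/=; rewrite Rintegral_cst// mul0r.
by rewrite -[RHS](rmorph_nat (real_complex R)).
Qed.

Lemma haar_complete_system (R : realType) (s : nat -> nat) :
  (forall m, exists n, s n = m) ->
  complete_system (fun n x => (haar (s n) x)%:C : R[i]).
Proof.
move=> sS f [mRe mIm fL2] e e0.
have mphi k : measurable_fun (`[0, 1[ : set R) (haar (s k)) by exact: measurable_haar.
have co : (`[0, 1[%classic : set R) `<=` `[0, 1]%classic.
  by move=> x /=; rewrite !in_itv/= => /andP[-> /ltW ->].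
have fin : (\int[lebesgue_measure]_(x in `[0%R, 1%R])
    (Normc.normc (f x) ^+ 2)%:E < +oo)%E.
  by move: fL2; rewrite L2normE; apply: lty_poweRy.
have part (v : R -> R) : measurable_fun (`[0, 1] : set R) v ->
    (forall x, v x ^+ 2 <= Normc.normc (f x) ^+ 2) ->
    l2_approx (fun k => haar (s k)) v.
  move=> mv vf; apply: l2_approx_dense => //.
  - by move=> m; have [n <-] := sS m; exact: l2_approx_base.
  - exact: measurable_funS mv.
  - apply: (@integrableS _ _ R (@lebesgue_measure R) `[0, 1]%classic) => //.
    apply/integrableP; split; first by apply/measurable_EFinP/measurable_funX.
    apply: le_lt_trans fin; apply: ge0_le_integralW => x _; first by [].
    by rewrite abse_EFin lee_fin ger0_norm ?sqr_ge0.
have [_ HRe] := part _ mRe (fun x => ltac:(by rewrite normc_sqr lerDl sqr_ge0)).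
have [_ HIm] := part _ mIm (fun x => ltac:(by rewrite normc_sqr lerDr sqr_ge0)).
have e8 : 0 < e ^+ 2 / 8 by rewrite divr_gt0// exprn_gt0.
have [n [c hc]] := HRe _ e8; have [m [d hd]] := HIm _ e8.
have [c' cE] : exists c', lincomb (fun k => haar (s k)) n c =
    lincomb (fun k => haar (s k)) (maxn n m) c'.
  by eexists; exact: lincomb_widen (leq_maxl n m).
have [d' dE] : exists d', lincomb (fun k => haar (s k)) m d =
    lincomb (fun k => haar (s k)) (maxn n m) d'.
  by eexists; exact: lincomb_widen (leq_maxr n m).
rewrite {}cE in hc; rewrite {}dE in hd.
move: (maxn n m) c' d' hc hd => N {n m}c {}d hc hd.
exists N, (fun k => c k +i* d k).
apply: (@le_lt_trans _ _ (e / 2)%:E); last by rewrite lte_fin; lra.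
apply: L2norm_le; first lra.
have gE x : Normc.normc (f x - \sum_(k < N) (c k +i* d k) * (haar (s k) x)%:C) ^+ 2 =
    (complex.Re (f x) - lincomb (fun k => haar (s k)) N c x) ^+ 2 +
    (complex.Im (f x) - lincomb (fun k => haar (s k)) N d x) ^+ 2.
  rewrite normc_sqr !raddfB/= !raddf_sum/=.
  by congr ((_ + _) ^+ 2 + (_ + _) ^+ 2); apply: eq_bigr => k _;
    rewrite mulr0 ?subr0 ?add0r.
under eq_integral do rewrite gE EFinD.
have mB (v : R -> R) b : measurable_fun (`[0, 1] : set R) v ->
    measurable_fun (`[0, 1] : set R)
      (fun x => ((v x - lincomb (fun k => haar (s k)) N b x) ^+ 2)%:E).
  move=> mv; apply/measurable_EFinP/measurable_funX/measurable_funB => //.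
  by apply: measurable_lincomb => k; exact: measurable_haar.
rewrite ge0_integralD//; try exact: mB.
- rewrite -!integral_itv_bndo_bndc; try exact: measurable_funS (mB _ _ _).
  apply/ltW; apply: lt_le_trans (lteD hc hd) _.
  by rewrite -EFinD lee_fin expr_div_n; lra.
- by move=> x _; rewrite lee_fin sqr_ge0.
- by move=> x _; rewrite lee_fin sqr_ge0.
Qed.

Theorem theorem21 (R : realType) :
  exists C : R, 0 < C /\
  forall w : nat -> R,
    (forall n, 0 < w n) ->
    (forall m n : nat, (m <= n)%N -> w m <= w n) ->
    w n @[n --> \oo] --> +oo ->
  exists phi : nat -> R -> R[i],
    orthonormal_system phi /\ complete_system phi /\
    exists N0 : nat, forall N : nat, (N0 <= N)%N ->
      forall a : 'I_N -> R[i],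
        (L2V2norm phi a <=
         (C * w N * Num.sqrt (\sum_(n < N) Normc.normc (a n) ^+ 2))%:E)%E.
Proof.
exists 1; split=> // w w0 mw winf.
have [p [mp wp]] := sparse_sequence mw winf.
have pI : injective p.
  move=> i j e; case: (ltngtP i j) => // /mp; rewrite e ltnn //.
have [s [sI sS sE]] := interleave_bijection pI separated_index_inj.
exists (fun n x => (haar (s n) x)%:C).
split; first exact: haar_orthonormal_system.
split; first exact: haar_complete_system.
exists (p 0).+1 => N p0N a; rewrite mul1r.
have wN1 : 1 <= w N.
  apply: le_trans (mw _ _ (ltnW p0N)); apply: le_trans (wp 0%N); lra.
have S0 : 0 <= \sum_(n < N) Normc.normc (a n) ^+ 2.
  by apply: sumr_ge0 => n _; exact: sqr_ge0.
apply: L2norm_le; first by rewrite mulr_ge0 ?sqrtr_ge0// ltW.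
rewrite exprMn sqr_sqrtr//.
apply: (@le_trans _ _ (\int[lebesgue_measure]_(x in `[0%R, 1%R])
    \sum_(n < N) ((w N ^+ 2 * Normc.normc (a n) ^+ 2)%:E * (haar (s n) x ^+ 2)%:E))%E).
  apply: ge0_le_integralW => x; first by rewrite lee_fin sqr_ge0.
  rewrite /= in_itv/= => /andP[x0 _].
  have [M Mw cM] := active_card mw mp wp sE p0N x0.
  rewrite (eq_bigr (fun n => (w N ^+ 2 * Normc.normc (a n) ^+ 2 * haar (s n) x ^+ 2)%:E)).
    2: by move=> n _; rewrite EFinM.
  rewrite sumEFin lee_fin.
  apply: (@le_trans _ _ (M%:R * \sum_(n < N) Normc.normc (a n * (haar (s n) x)%:C) ^+ 2)).
    apply: V2norm_le; apply: leq_trans cM; apply: subset_leq_card.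
    apply/fintype.subsetP => n; rewrite !finset.inE; apply: contraNN => /eqP ->.
    by rewrite mulr0.
  rewrite [leRHS](_ : _ = w N ^+ 2 *
      \sum_(n < N) (Normc.normc (a n) ^+ 2 * haar (s n) x ^+ 2)); last first.
    by rewrite mulr_sumr; apply: eq_bigr => n _; rewrite -[LHS]mulrA.
  apply: ler_pM => //.
  - by apply: sumr_ge0 => n _; exact: sqr_ge0.
  - by apply: le_trans Mw _; rewrite expr2 ler_peMl// ltW.
  - apply: ler_sum => n _; rewrite Normc.normcM exprMn.
    by rewrite [X in _ * X]normc_sqr/= expr0n addr0.
rewrite ge0_integral_sum//.
- rewrite mulr_sumr -sumEFin; apply: lee_sum => n _.
  rewrite ge0_integralZl//.
  + by rewrite integral_haar_sqr mule1.
  + by apply/measurable_EFinP/measurable_funX; exact: measurable_haar.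
  + by move=> x _; rewrite lee_fin sqr_ge0.
  + by rewrite lee_fin mulr_ge0 ?sqr_ge0.
- move=> n; apply: emeasurable_funM => //.
  by apply/measurable_EFinP/measurable_funX; exact: measurable_haar.
- by move=> n x _; rewrite -EFinM lee_fin mulr_ge0 ?sqr_ge0// mulr_ge0 ?sqr_ge0.
Qed.
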